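(* Let $\mathcal T$ be an oscillating tableau of length $r$, and let $Q$ be the standard Young tableau produced from $\mathcal T$ by Sundaram's correspondence (as described in the context). Then $\mathrm{Des}(\mathcal T)=\mathrm{Des}(Q)$.
   Context: An oscillating tableau of length $r$ is a sequence of partitions $(\emptyset=\mu^0,\dots,\mu^r)$ with consecutive Ferrers diagrams (English notation) differing by exactly one box; step $k$ is an expansion or contraction according as the box $b_k$ is added or removed. $\mathrm{Des}(\mathcal T)$ is the set of $k\in\{1,\dots,r-1\}$ such that (i) step $k$ is an expansion and step $k+1$ a contraction, or (ii) both are expansions and $b_k$ is in a row strictly above $b_{k+1}$, or (iii) both are contractions and $b_k$ is in a row strictly below $b_{k+1}$. A partial Young tableau is a filling of a Ferrers shape by distinct positive integers increasing along rows and down columns; its descent set is $\{k: k,k+1 \text{ are entries and } k+1 \text{ lies in a row strictly below } k\}$. Column insertion of $x$ into a partial tableau: insert $x$ into the first column; if $x$ exceeds all entries of the column it is placed at the bottom of it, otherwise it replaces the smallest entry larger than $x$, and the replaced entry is inserted in the same way into the next column, and so on. Column deletion of the entry $y$ in a corner box lying in column $j$: remove it, then for the columns $j-1,j-2,\dots,1$ in turn replace the largest entry smaller than the current $y$ by $y$ and let $y$ be the replaced entry; the final $y$ is the output $x$. Sundaram's correspondence: (1) Set $\iota_0=\emptyset$, $T_0=\emptyset$. For $k=1,\dots,r$: if step $k$ is an expansion, $\iota_k=\iota_{k-1}$ and $T_k$ is $T_{k-1}$ with $k$ placed in box $b_k$; if step $k$ is a contraction, column-delete the entry of box $b_k$ from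 $T_{k-1}$, obtaining output $x$ and tableau $T_k$, and let $\iota_k$ be $\iota_{k-1}$ with the transposition $(x,k)$ adjoined. Let $\iota=\iota_r$ (a fixed-point-free involution on a set $A\subseteq\{1,\dots,r\}$) and $T=T_r$ (a partial tableau with entry set $\{1,\dots,r\}\setminus A$). (2) Writing $A=\{a_1<\dots<a_m\}$, let $I$ be the Robinson–Schensted (row) insertion tableau of the word $\iota(a_1)\iota(a_2)\cdots\iota(a_m)$. (3) Let the reverse reading word of $I$ be the word obtained by reading the rows of $I$ from top to bottom, each row from right to left. $Q$ is the tableau obtained by column inserting the letters of this word, in order, into $T$; it is a standard Young tableau with $r$ boxes. *)

(* Defs.v *)
From mathcomp Require Import all_boot.
Set Implicit Arguments. Unset Strict Implicit. Unset Printing Implicit Defensive.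

(* A partition is its weakly decreasing list of (positive) row lengths;
   rows are indexed from 0 (top row) downwards, columns from 0. *)
Definition is_part (s : seq nat) : bool := sorted geq s && all (leq 1) s.

Definition osc_tab (r : nat) (mus : seq (seq nat)) : Prop :=
  [/\ size mus = r.+1, nth [::] mus 0 = [::], all is_part mus &
      forall k, k < r ->
        exists i, nth [::] mus k.+1 = incr_nth (nth [::] mus k) i \/
                  nth [::] mus k = incr_nth (nth [::] mus k.+1) i].

Definition shape_before (mus : seq (seq nat)) k := nth [::] mus k.-1.
Definition shape_after (mus : seq (seq nat)) k := nth [::] mus k.

Definition is_exp (mus : seq (seq nat)) k : bool :=
  sumn (shape_before mus k) < sumn (shape_after mus k).

Definition box_row (mus : seq (seq nat)) k : nat :=
  let a := shape_before mus k in let b := shape_after mus k in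
  find (fun i => nth 0 a i != nth 0 b i) (iota 0 (size a + size b)).

Definition box_col (mus : seq (seq nat)) k : nat :=
  let i := box_row mus k in
  minn (nth 0 (shape_before mus k) i) (nth 0 (shape_after mus k) i).

Definition DesOsc (r : nat) (mus : seq (seq nat)) (k : nat) : bool :=
  [&& 0 < k, k < r &
   let e1 := is_exp mus k in let e2 := is_exp mus k.+1 in
   let r1 := box_row mus k in let r2 := box_row mus k.+1 in
   [|| e1 && ~~ e2, [&& e1, e2 & r1 < r2] | [&& ~~ e1, ~~ e2 & r2 < r1]]].

(* A tableau is stored either as its list of rows (top to bottom) or as
   its list of columns (left to right); each list is read increasingly.
   T and Q below are stored by columns, I by rows. *)

(* Insertion of x into a list of increasing lines L: x goes into the first
   line; if it exceeds all entries it is appended at its end, otherwise it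
   replaces the smallest entry larger than x, which is inserted into the
   next line, and so on.  On rows this is Robinson–Schensted row insertion;
   on columns it is column insertion. *)
Fixpoint line_ins (L : seq (seq nat)) (x : nat) : seq (seq nat) :=
  match L with
  | [::] => [:: [:: x]]
  | l :: L' =>
      if all (fun z => z < x) l then rcons l x :: L'
      else let i := find (fun z => x < z) l in
           set_nth 0 l i x :: line_ins L' (nth 0 l i)
  end.

Definition place (T : seq (seq nat)) (i j k : nat) : seq (seq nat) :=
  set_nth [::] T j (set_nth 0 (nth [::] T j) i k).

(* in an increasing column c, replace the largest entry smaller than y by y;
   return (replaced entry, new column) *)
Definition col_repl (c : seq nat) (y : nat) : nat * seq nat :=
  let i := (count (fun z => z < y) c).-1 in (nth 0 c i, set_nth 0 c i y).

Fixpoint unbump_cols (cs : seq (seq nat)) (y : nat) : nat * seq (seq nat) :=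
  match cs with
  | [::] => (y, [::])
  | c :: cs' =>
      let p := unbump_cols cs' y in
      let q := col_repl c p.1 in (q.1, q.2 :: p.2)
  end.

Definition col_del (T : seq (seq nat)) (i j : nat) : nat * seq (seq nat) :=
  let c := nth [::] T j in
  let y := nth 0 c i in
  let c' := take i c ++ drop i.+1 c in
  let T1 := if c' is [::] then take j T ++ drop j.+1 T
            else set_nth [::] T j c' in
  let p := unbump_cols (take j T1) y in
  (p.1, p.2 ++ drop j T1).

(* state: (list of transpositions (x,k) of iota, column-stored tableau T) *)
Definition sund_step (mus : seq (seq nat))
    (st : seq (nat * nat) * seq (seq nat)) (k : nat)
    : seq (nat * nat) * seq (seq nat) :=
  let i := box_row mus k in let j := box_col mus k in
  if is_exp mus k then (st.1, place st.2 i j k)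
  else let p := col_del st.2 i j in (rcons st.1 (p.1, k), p.2).

Definition sund_phase1 (r : nat) (mus : seq (seq nat)) :=
  foldl (sund_step mus) ([::], [::]) (iota 1 r).

(* the involution as a function on its support *)
Definition inv_apply (p : seq (nat * nat)) (a : nat) : nat :=
  match [seq q <- p | (q.1 == a) || (q.2 == a)] with
  | q :: _ => if q.1 == a then q.2 else q.1
  | [::] => 0
  end.

Definition inv_support (p : seq (nat * nat)) : seq nat :=
  sort leq (flatten [seq [:: q.1; q.2] | q <- p]).

Definition RS_I (p : seq (nat * nat)) : seq (seq nat) :=
  foldl line_ins [::] [seq inv_apply p a | a <- inv_support p].

Definition rev_reading (I : seq (seq nat)) : seq nat :=
  flatten [seq rev row | row <- I].

Definition sundaram_Q (r : nat) (mus : seq (seq nat)) : seq (seq nat) :=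
  let st := sund_phase1 r mus in
  foldl line_ins st.2 (rev_reading (RS_I st.1)).

Definition row_of (T : seq (seq nat)) (x : nat) : nat :=
  index x (nth [::] T (find (fun c => x \in c) T)).

Definition DesTab (T : seq (seq nat)) (k : nat) : bool :=
  [&& k \in flatten T, k.+1 \in flatten T & row_of T k < row_of T k.+1].

(* Main.v *)
Require Import Defs.
From mathcomp Require Import all_boot.
From mathcomp Require Import zify.
Set Implicit Arguments. Unset Strict Implicit. Unset Printing Implicit Defensive.

(** Call k a line descent of a list of increasing lines when k+1 lies in a
strictly later line than k.  Inserting a letter other than k, k+1 preserves this
property, inserting k+1 when k is present makes it false, and inserting k when
k+1 is present makes it true.  On rows, line descents are descents; on the
columns of a tableau they are exactly the non-descents.  Hence k is a descent of
Q iff: k+1 is strictly below k in T, when both are entries of T; k is an entry of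
T, when exactly one is; iota(k+1) < iota(k), when both lie in A.

That this last condition also characterises the descents of the oscillating
tableau is an invariant of the first phase: column deletion is inverse to column
insertion, so the three insertion rules show that it persists once k+1 steps are
done, and the bumping lemma settles two consecutive contractions.  Since
consecutive shapes are partitions, comparing the rows of two consecutive boxes
amounts to comparing their columns. *)

(** * Line insertion and line descents *)

(** No condition links different lines beyond distinctness of entries. The descent rules need
    nothing more, and so they serve both row insertion and column insertion. *)
Definition lines (L : seq (seq nat)) := all (sorted ltn) L && uniq (flatten L).

(* [lia] is prohibitively slow on contexts full of hypotheses about sequences. *)
Ltac arith :=
  repeat match goal with
  | H : is_true (all _ _) |- _ => clear H
  | H : is_true (sorted _ _) |- _ => clear H
  | H : is_true (uniq _) |- _ => clear H
  | H : is_true (perm_eq _ _) |- _ => clear H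
  | H : is_true (~~ has _ _) |- _ => clear H
  | H : is_true (_ && _) |- _ => clear H
  | H : is_true (lines _) |- _ => clear H
  | H : is_true (in_mem _ _) |- _ => clear H
  | H : is_true (~~ in_mem _ _) |- _ => clear H
  | H : @eq (seq _) _ _ |- _ => clear H
  | H : forall _, _ |- _ => clear H
  end; lia.

Lemma sorted_ltn_cat (a e : seq nat) :
  sorted ltn (a ++ e) -> sorted ltn a /\ sorted ltn e.
Proof. by case/cat_sorted2. Qed.

Lemma sorted_ltn_split (a e : seq nat) y :
  sorted ltn (a ++ y :: e) ->
  [/\ all (fun z => z < y) a, all (fun z => y < z) e,
      sorted ltn a & sorted ltn e].
Proof.
rewrite (sorted_pairwise ltn_trans) pairwise_cat /= allrel_consr.
by rewrite -!(sorted_pairwise ltn_trans); case/and4P => /andP[? _] ? ? ?.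
Qed.

Lemma sorted_ltn_join (a e : seq nat) y :
  all (fun z => z < y) a -> all (fun z => y < z) e ->
  sorted ltn a -> sorted ltn e -> sorted ltn (a ++ y :: e).
Proof.
rewrite !(sorted_pairwise ltn_trans) pairwise_cat /= allrel_consr => Ha He -> ->.
rewrite Ha He !andbT /=; apply/allrelP => u v /(allP Ha) uy /(allP He).
exact: ltn_trans.
Qed.

(* Covers in one formula the three ways an insertion can begin: in an empty
   tableau, at the end of the first line, or by bumping the head of [e]. *)
Lemma line_insE L x :
  sorted ltn (head [::] L) -> x \notin head [::] L ->
  exists a e, [/\ head [::] L = a ++ e, all (fun z => z < x) a,
    all (fun z => x < z) e &
    line_ins L x = (a ++ x :: behead e) ::
      (if e is y :: _ then line_ins (behead L) y else behead L)].
Proof.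
case: L => [|l L] /= sl xl; first by exists [::], [::].
case: ifPn => [lx|nlx].
  by exists l, [::]; rewrite cats0 cats1.
have hx : has (fun z => x < z) l.
  rewrite -has_predC in nlx; case/hasP: nlx => z zl /=; rewrite -leqNgt => xz.
  apply/hasP; exists z => //=; rewrite ltn_neqAle xz andbT.
  by apply: contraNneq xl => ->.
set i := find _ l.
have il : i < size l by rewrite -has_find.
have el : l = take i l ++ nth 0 l i :: drop i.+1 l.
  by rewrite -(drop_nth 0 il) cat_take_drop.
have xy : x < nth 0 l i by exact: (nth_find 0 hx).
have ax : all (fun z => z < x) (take i l).
  apply/allP => z zi; have zl := mem_take zi.
  have := zi; move/(nthP 0) => [j]; rewrite size_take il => ji.
  rewrite nth_take // => ez; have := before_find 0 ji; rewrite ez => /negbT.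
  rewrite -leqNgt leq_eqVlt => /orP[/eqP zx|//].
  by rewrite -zx zl in xl.
exists (take i l), (nth 0 l i :: drop i.+1 l); split => //.
  rewrite el in sl; case/sorted_ltn_split: sl => _ h _ _ /=.
  by rewrite xy; apply/allP => z /(allP h); apply: ltn_trans.
by rewrite /= set_nthE il.
Qed.


Definition line (L : seq (seq nat)) x := find (fun c => x \in c) L.

Lemma line_ltn_size L x : (line L x < size L) = (x \in flatten L).
Proof. rewrite -has_find; apply/hasP/flattenP => -[c ? ?]; by exists c. Qed.

Lemma linesE l L : lines (l :: L) =
  [&& sorted ltn l, lines L, uniq l & ~~ has (mem l) (flatten L)].
Proof.
rewrite /lines /= cat_uniq.
by case: (sorted ltn l); case: (all _ L); case: (uniq l); case: (has _ _);
   case: (uniq _).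
Qed.

Lemma lines_head L : lines L -> sorted ltn (head [::] L).
Proof. by case: L => //= l L; rewrite linesE => /and4P[]. Qed.

Lemma flatten_head_behead (L : seq (seq nat)) :
  flatten L = head [::] L ++ flatten (behead L).
Proof. by case: L. Qed.

(** The form suited to induction on the lines: the bumped entry [y] is again a fresh letter for
    [L]. *)
Lemma line_ins_cons l L x : lines (l :: L) -> x \notin flatten (l :: L) ->
  (line_ins (l :: L) x = rcons l x :: L /\ all (fun z => z < x) l) \/
  (exists a y e, [/\ l = a ++ y :: e, y \notin flatten L,
     all (fun z => z < x) a, x < y /\ all (fun z => y < z) e &
     line_ins (l :: L) x = (a ++ x :: e) :: line_ins L y]).
Proof.
move=> wl; have := wl; rewrite linesE => /and4P[sl wL ul hl].
rewrite [flatten _]/= mem_cat negb_or => /andP[xl xL].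
have [a [e [/= el ae ee ->]]] := line_insE (lines_head wl) xl.
case: e el ee => [|y e] el ee.
  by left; rewrite el cats0 cats1.
right; exists a, y, e; split=> //.
  apply: contra hl => yL; apply/hasP; exists y => //=.
  by rewrite el mem_cat mem_head orbT.
split; first by case/andP: ee.
by rewrite el in sl; case/sorted_ltn_split: sl.
Qed.

Lemma line_ins_perm L x : lines L -> x \notin flatten L ->
  perm_eq (flatten (line_ins L x)) (x :: flatten L).
Proof.
elim: L x => [|l L IH] x; first by [].
move=> wl xl; have := wl; rewrite linesE => /and4P[_ wL _ _].
case: (line_ins_cons wl xl) => [[-> _]|[a [y [e [-> yL _ _ ->]]]]] /=.
  by rewrite cat_rcons -cat1s perm_catCA.
apply/permP => P; have /permP/(_ P) := IH _ wL yL.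
rewrite /= !count_cat /= => ->; arith.
Qed.

Lemma line_ins_mem L x z : lines L -> x \notin flatten L ->
  (z \in flatten (line_ins L x)) = (z == x) || (z \in flatten L).
Proof. by move=> wl xl; rewrite (perm_mem (line_ins_perm wl xl)) in_cons. Qed.

Lemma line_ins_lines L x : lines L -> x \notin flatten L ->
  lines (line_ins L x).
Proof.
move=> wl xl; rewrite /lines (perm_uniq (line_ins_perm wl xl)) /= xl.
have /andP[_ ->] := wl; rewrite !andbT.
elim: L x wl xl => [|l L IH] x; first by [].
move=> wl xl; have := wl; rewrite linesE => /and4P[sl wL _ _].
case: (line_ins_cons wl xl) => [[-> lx]|[a [y [e [el yL ax [xy ye] ->]]]]] /=.
  by rewrite -cats1 sorted_ltn_join //=; case/andP: wL.
rewrite IH // andbT; rewrite el in sl; case/sorted_ltn_split: sl => _ _ sa se.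
by apply: sorted_ltn_join => //; apply/allP => z /(allP ye); apply: ltn_trans.
Qed.

Definition line_desc L k := line L k < line L k.+1.

Lemma line_cons l L x :
  line (l :: L) x = if x \in l then 0 else (line L x).+1.
Proof. by []. Qed.

(** The inserted letter lands in the first line, and nothing lies strictly before that. *)
Lemma line_ins_desc_succ L k : lines L -> k.+1 \notin flatten L ->
  k \in flatten L -> line_desc (line_ins L k.+1) k = false.
Proof.
case: L => [|l L] // wl kl _; rewrite /line_desc; apply/negbTE.
case: (line_ins_cons wl kl) => [[-> _]|[a [y [e [el yL _ _ ->]]]]];
  rewrite !line_cons ?mem_rcons ?mem_cat ?inE ?eqxx ?orbT //=; by rewrite -leqNgt.
Qed.

(** The letter [k] lands in the first line; had [k.+1] been there, it would be the smallest larger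
    entry and so would have been bumped. *)
Lemma line_ins_desc_pred L k : lines L -> k \notin flatten L ->
  k.+1 \in flatten L -> line_desc (line_ins L k) k.
Proof.
case: L => [|l L] // wl kl; rewrite /line_desc; have := wl.
rewrite linesE => /and4P[sl wL ul hl].
case: (line_ins_cons wl kl) => [[-> lk]|[a [y [e [el yL ak [ky ye] ->]]]]];
  rewrite !line_cons ?mem_rcons ?mem_cat ?inE ?eqxx ?orbT //=.
  case: ifP => // /orP[|/(allP lk)]; arith.
case: ifP => //; rewrite el; case/or3P=> [/(allP ak)| |/(allP ye)]; arith.
Qed.

(** Only the bumped entry [y] leaves the first line. If [y] is neither [k] nor [k.+1], induction
    applies or the first line decides; if [y] is one of them and the other lies in [L], one of the
    two preceding rules applies to the insertion of [y]. *)
Lemma line_ins_desc L x k : lines L -> x \notin flatten L ->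
  x != k -> x != k.+1 -> k \in flatten L -> k.+1 \in flatten L ->
  line_desc (line_ins L x) k = line_desc L k.
Proof.
elim: L x => [|l L IH] x // wl xl xk xk1.
have := wl; rewrite linesE => /and4P[sl wL ul hl].
rewrite [flatten _]/= !mem_cat => kl k1l; rewrite /line_desc.
case: (line_ins_cons wl xl) => [[-> lx]|[a [y [e [el yL ax [xy ye] ->]]]]].
  by rewrite !line_cons !mem_rcons !inE !(eq_sym _ x) (negbTE xk) (negbTE xk1).
have yl : y \in l by rewrite el mem_cat mem_head orbT.
have mle z : z \in l = [|| z \in a, z == y | z \in e].
  by rewrite el mem_cat in_cons.
have ya z : z \in a -> z != y by move/(allP ax); arith.
have ey z : z \in e -> z != y by move/(allP ye); arith.
have mlx z : z != x -> (z \in a ++ x :: e) = (z \in l) && (z != y).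
  move=> zx; rewrite mem_cat in_cons (negbTE zx) mle /=.
  case: (z \in a) (@ya z) => /= [->//|_]; case: (z \in e) (@ey z) => /= [->//|_].
    by rewrite orbT.
  by rewrite orbF andbN.
rewrite !line_cons !mlx 1?eq_sym //.
have [lk|nlk] /= := boolP (k \in l); have [lk1|nlk1] /= := boolP (k.+1 \in l).
(* With both letters in the first line, [k.+1] cannot be the bumped one: that would force
   [k < x < k.+1]. Bumping [k] moves it away from [k.+1] in the direction that creates no line
   descent. *)
- have [ek|nk] /= := eqVneq k y; have [ek1|nk1] //= := eqVneq k.+1 y; first arith.
  have ka : k \in a.
    move: lk; rewrite mle (negbTE nk) => /orP[//|/(allP ye)]; arith.
  have := allP ax _ ka; arith.
- have k1L : k.+1 \in flatten L by move: k1l; rewrite (negbTE nlk1).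
  have [ek|nk] //= := eqVneq k y; have := line_ins_desc_pred wL yL.
  by rewrite -ek => /(_ k1L).
- have kL : k \in flatten L by move: kl; rewrite (negbTE nlk).
  have [ek1|nk1] //= := eqVneq k.+1 y.
  rewrite -ek1 in yL *; exact: (line_ins_desc_succ wL yL kL).
- rewrite (negbTE nlk) /= in kl; rewrite (negbTE nlk1) /= in k1l.
  apply: (IH _ wL yL) => //.
    by apply: contraNneq nlk => <-.
  by apply: contraNneq nlk1 => <-.
Qed.

(** A contraction is undone by a column insertion, and the column of its box is where that insertion
    ends. *)
Fixpoint ins_end (L : seq (seq nat)) (x : nat) : nat :=
  match L with
  | [::] => 0
  | l :: L' => if all (fun z => z < x) l then 0
               else (ins_end L' (nth 0 l (find (fun z => x < z) l))).+1
  end.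

Lemma ins_end_rcons l L x : all (fun z => z < x) l -> ins_end (l :: L) x = 0.
Proof. by move=> /= ->. Qed.

Lemma ins_end_bump a y e L x : all (fun z => z < x) a -> x < y ->
  ins_end ((a ++ y :: e) :: L) x = (ins_end L y).+1.
Proof.
move=> ax xy /=; rewrite all_cat /= (ltnNge y x) (ltnW xy) andbF find_cat.
have -> : has (fun z => x < z) a = false.
  by apply/negbTE/hasPn => z /(allP ax); arith.
by rewrite /= xy addn0 nth_cat ltnn subnn.
Qed.

(* The bumping lemma: [x'] is inserted first, then [x]. *)
Lemma ins_end_leq L x x' : lines L -> x' \notin flatten L ->
  x \notin flatten L -> x != x' ->
  (ins_end (line_ins L x') x <= ins_end L x') = (x' < x).
Proof.
elim: L x x' => [|l L IH] x x' wl x'l xl xx'.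
  rewrite /= andbT; case: ltnP; arith.
have := wl; rewrite linesE => /and4P[sl wL ul hl].
case: (line_ins_cons wl x'l) => [[-> lx']|[a [y [e [el yL ax [xy ye] E]]]]].
  rewrite (ins_end_rcons _ lx') /= all_rcons.
  case: ltnP => x'x /=; last by rewrite leqn0.
  by rewrite (_ : all _ l) //; apply/allP => z /(allP lx'); arith.
have wl' := line_ins_lines wl x'l.
have xl' : x \notin flatten (line_ins (l :: L) x').
  by rewrite line_ins_mem // negb_or xx'.
rewrite E {1}el ins_end_bump //; rewrite E in wl' xl'.
have yl : y \in l by rewrite el mem_cat mem_head orbT.
case: (line_ins_cons wl' xl') => [[_ lx]|[a1 [y1 [e1 [el1 y1L a1x [xy1 ye1] _]]]]].
  rewrite ins_end_rcons // leq0n; apply/esym/(allP lx).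
  by rewrite mem_cat mem_head orbT.
rewrite el1 ins_end_bump // ltnS.
have y1m : y1 \in a ++ x' :: e by rewrite el1 mem_cat mem_head orbT.
have y1L' : y1 \notin flatten L.
  by move: y1L; rewrite line_ins_mem // negb_or => /andP[].
have y1y : y1 != y.
  by move: y1L; rewrite line_ins_mem // negb_or => /andP[].
rewrite IH //.
(* It remains to compare the two bumped entries. If [x' < x], then [y1] lies in [e] and exceeds [y];
   otherwise [y1] is at most [x'], hence below [y]. *)
have x'm : x' \in a1 ++ y1 :: e1 by rewrite -el1 mem_cat mem_head orbT.
move: y1m x'm; rewrite !mem_cat !inE.
case/or3P => [/(allP ax)|/eqP|/(allP ye)] h1;
case/or3P => [/(allP a1x)|/eqP|/(allP ye1)] h2; arith.
Qed.

(** * Inserting and reading whole words *)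

Lemma foldl_line_ins_perm w L : lines L -> uniq (flatten L ++ w) ->
  lines (foldl line_ins L w) /\ perm_eq (flatten (foldl line_ins L w)) (flatten L ++ w).
Proof.
elim: w L => [|x w IH] L wL; first by rewrite cats0.
move=> u; have xL : x \notin flatten L.
  by move: u; rewrite cat_uniq /= negb_or => /and3P[_ /andP[]].
have pe : perm_eq (flatten (line_ins L x) ++ w) (flatten L ++ x :: w).
  by rewrite perm_sym -cat1s perm_catCA catA perm_cat2r perm_sym line_ins_perm.
have := IH _ (line_ins_lines wL xL); rewrite (perm_uniq pe) => /(_ u)[? p].
by split=> //=; apply: perm_trans p pe.
Qed.

(** When at least one of [k], [k.+1] is in [w], the one that arrives last fixes the line descent,
    and the remaining letters preserve it. Entries of [L] count as arriving before all of [w]. *)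
Lemma foldl_line_ins_desc w L k : lines L -> uniq (flatten L ++ w) ->
  k \in flatten L ++ w -> k.+1 \in flatten L ++ w ->
  line_desc (foldl line_ins L w) k =
    if k \in flatten L then
      (if k.+1 \in flatten L then line_desc L k else false)
    else (k.+1 \in flatten L) || (index k.+1 w < index k w).
Proof.
elim: w L => [|x w IH] L wL; first by rewrite cats0 => _ -> ->.
move=> u kL k1L; have xL : x \notin flatten L.
  by move: u; rewrite cat_uniq /= negb_or => /and3P[_ /andP[]].
have pe : perm_eq (flatten (line_ins L x) ++ w) (flatten L ++ x :: w).
  by rewrite perm_sym -cat1s perm_catCA catA perm_cat2r perm_sym line_ins_perm.
rewrite /= IH ?line_ins_lines ?(perm_uniq pe) ?(perm_mem pe) // !line_ins_mem //.
have [kx|nkx] := eqVneq k x.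
  have [?|nk1x] := eqVneq k.+1 x; first arith.
  rewrite -kx in xL *; rewrite (negbTE xL) /= ltn0 orbF.
  by case: ifP => // k1; rewrite line_ins_desc_pred.
have [k1x|nk1x] /= := eqVneq k.+1 x.
  rewrite -k1x in xL *; rewrite (negbTE xL) /=.
  by case: ifP => // kl; rewrite line_ins_desc_succ.
rewrite ltnS; case: ifP => // kl; case: ifP => // k1l.
by rewrite line_ins_desc // eq_sym.
Qed.

(** The inequality of lines is weak because each row is read from right to left: of two entries in
    one row the larger comes first. *)
Lemma index_rev_reading L a b : lines L -> a < b ->
  a \in flatten L -> b \in flatten L ->
  (index b (rev_reading L) < index a (rev_reading L)) = (line L b <= line L a).
Proof.
elim: L => [|l L IH] // wl ab; have := wl.
rewrite linesE => /and4P[sl wL ul hl].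
rewrite !line_cons /rev_reading /= !index_cat !mem_rev !mem_cat => al bl.
have sr : sorted gtn (rev l) by rewrite rev_sorted.
have tr : transitive gtn by move=> u v w; rewrite /=; arith.
case: (boolP (a \in l)) al => /= la al; case: (boolP (b \in l)) bl => /= lb bl.
- rewrite leqnn ltnNge; apply/negP => h.
  have : index a (rev l) < index b (rev l).
    rewrite ltn_neqAle h andbT; apply: contraTneq ab => e.
    have := nth_index 0 (_ : a \in rev l); rewrite mem_rev => /(_ la).
    by rewrite e nth_index ?mem_rev // => ->; rewrite ltnn.
  move/(sorted_ltn_index tr sr _ _); rewrite !mem_rev => /(_ la lb) /=; arith.
- apply/negbTE; have : index a (rev l) < size (rev l) by rewrite index_mem mem_rev.
  arith.
- have : index b (rev l) < size (rev l) by rewrite index_mem mem_rev.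
  arith.
- by rewrite ltn_add2l ltnS; apply: IH.
Qed.

(** * Column-stored tableaux *)

(** The row condition of a tableau, for a column [c] and its right neighbour [d]. *)
Definition dom (c d : seq nat) : Prop :=
  size d <= size c /\ forall i, i < size d -> nth 0 c i < nth 0 d i.

(** Columns are nonempty so that an empty head can only mean that no column is left; [dom] holds
    trivially against it. *)
Fixpoint tab (T : seq (seq nat)) : Prop :=
  if T is c :: T' then
    [/\ c != [::], sorted ltn c, dom c (head [::] T') & tab T']
  else True.

Lemma nth_cat_cons (T : Type) (x0 : T) a y e i :
  nth x0 (a ++ y :: e) i =
  if i < size a then nth x0 a i else if i == size a then y
  else nth x0 e (i - (size a).+1).
Proof.
rewrite nth_cat; case: ltnP => // ai; case: eqP => [->|ne]; first by rewrite subnn.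
by have -> : i - size a = (i - (size a).+1).+1 by arith.
Qed.

(** A bumped entry moves weakly upwards: in its old row the next column, if it reaches that far,
    holds something larger than [y], whence [size a2 <= size a]. Each row is then compared
    separately. The use of [behead e] treats appending and bumping in the next column together. *)
Lemma dom_ins (a b a2 e : seq nat) x y :
  sorted ltn (a ++ y :: b) -> x < y ->
  all (fun z => z < y) a2 -> all (fun z => y < z) e ->
  dom (a ++ y :: b) (a2 ++ e) ->
  dom (a ++ x :: b) (a2 ++ y :: behead e).
Proof.
move=> /sorted_ltn_split[ay _ _ _] xy a2y ye [sz h].
have a2a : size a2 <= size a.
  rewrite leqNgt; apply/negP => lt.
  have := h (size a); rewrite nth_cat_cons ltnn eqxx nth_cat lt size_cat => /(_ _) hh.
  have := allP a2y (nth 0 a2 (size a)) (mem_nth 0 lt); move: hh; arith.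
rewrite /dom; move: sz h; rewrite !size_cat /= size_behead => sz h; split; first arith.
move=> i ilt; rewrite !nth_cat_cons.
case: (ltnP i (size a2)) => [i2|i2].
  have ia : i < size a by arith.
  by rewrite ia; have := h i; rewrite nth_cat_cons nth_cat i2 ia; apply; arith.
case: (eqVneq i (size a2)) => [ei|ni].
  case: (ltnP i (size a)) => ia; last by rewrite (_ : i == size a) //; arith.
  exact: (allP ay) (mem_nth 0 ia).
have ie : i - size a2 < size e by arith.
have := h i; rewrite nth_cat_cons nth_cat (ltnNge i (size a2)) i2 /=.
have -> : nth 0 (behead e) (i - (size a2).+1) = nth 0 e (i - size a2).
  by rewrite nth_behead; congr nth; arith.
have := allP ye _ (mem_nth 0 ie).
move=> h1 h2; case: (ltnP i (size a)) h2 => ia h2; first by apply: h2; arith.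
case: (eqVneq i (size a)) h2 => [_ _|_ h2]; last by apply: h2; arith.
exact: ltn_trans xy h1.
Qed.

Lemma tab_head T : tab T -> sorted ltn (head [::] T).
Proof. by case: T => //= c T []. Qed.

Lemma tab_sorted T : tab T -> all (sorted ltn) T.
Proof. by elim: T => //= c T IH [_ -> _ /IH]. Qed.

Lemma line_ins_tab T x : tab T -> uniq (flatten T) -> x \notin flatten T ->
  tab (line_ins T x).
Proof.
elim: T x => [|c T IH] x; first by [].
move=> tT uT xT; have wT : lines (c :: T) by rewrite /lines tab_sorted.
have := line_ins_lines wT xT; have [nc sc dc tT'] := tT.
have := wT; rewrite linesE => /and4P[_ wT' _ _].
have uT' : uniq (flatten T) by case/andP: wT'.
case: (line_ins_cons wT xT) => [[-> lx]|[a [y [e [el yL ax [xy ye] ->]]]]];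
  rewrite linesE => /and4P[sc' _ _ _].
  split=> //; first by case: (c).
  case: dc => sz h; split; first by rewrite size_rcons; arith.
  by move=> i /[dup] it /h; rewrite nth_rcons (leq_trans it sz).
split=> //; [by case: (a) | | exact: IH].
have yT : y \notin head [::] T.
  by move: yL; rewrite flatten_head_behead mem_cat negb_or => /andP[].
have [a2 [e2 [hd a2y ye2 ->]]] := line_insE (tab_head tT') yT.
by rewrite hd el in dc; rewrite el in sc; apply: dom_ins dc.
Qed.

Lemma foldl_line_ins_tab w T : tab T -> uniq (flatten T ++ w) ->
  tab (foldl line_ins T w).
Proof.
elim: w T => [|x w IH] T tT //= u.
have := u; rewrite cat_uniq /= negb_or => /and3P[uT /andP[xT _] _].
apply: IH; first exact: line_ins_tab.
have wT : lines T by rewrite /lines tab_sorted.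
rewrite (perm_uniq (_ : perm_eq _ (flatten T ++ x :: w))) //.
by rewrite perm_sym -cat1s perm_catCA catA perm_cat2r perm_sym line_ins_perm.
Qed.

Lemma tab_nth T j : tab T -> [/\ sorted ltn (nth [::] T j),
  dom (nth [::] T j) (nth [::] T j.+1) & j < size T -> nth [::] T j != [::]].
Proof.
elim: T j => [|c T IH] j /=; first by rewrite nth_nil; split=> //; split.
move=> [nc sc dc tT]; case: j => [|j] /=; last by apply: IH.
by split=> //; rewrite nth0.
Qed.

(** The term [j' - j] is the strict growth along the row, one unit per column. *)
Lemma tab_dom T j i j' : tab T -> j <= j' -> i < size (nth [::] T j') ->
  i < size (nth [::] T j) /\
  nth 0 (nth [::] T j) i + (j' - j) <= nth 0 (nth [::] T j') i.
Proof.
move=> tT /subnKC <-; elim: (j' - j) => [|d IH]; first by rewrite addn0 subnn addn0.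
rewrite addnS => h; have [_ [sz lt] _] := tab_nth (j + d) tT.
have [] := IH (leq_trans h sz); have := lt _ h; split=> //; arith.
Qed.

Lemma ltn_sorted_nth (s : seq nat) i j : sorted ltn s -> i < j -> j < size s ->
  nth 0 s i < nth 0 s j.
Proof.
move=> ss ij js; apply: (sorted_ltn_nth ltn_trans 0 ss) => //.
by rewrite inE; apply: ltn_trans js.
Qed.

(** Two relative positions are impossible. If [k.+1] were strictly below and strictly right of [k],
    the entry in the row of [k] and the column of [k.+1] would lie strictly between them; and [k.+1]
    cannot be weakly above and weakly left of [k]. *)
Lemma row_of_desc T k : tab T -> k \in flatten T -> k.+1 \in flatten T ->
  (row_of T k < row_of T k.+1) = ~~ line_desc T k.
Proof.
move=> tT kT k1T; rewrite /row_of /line_desc -leqNgt -!/(line _ _).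
set j := line T k; set j' := line T k.+1.
have mj z : z \in flatten T -> z \in nth [::] T (line T z).
  by move=> zT; apply: (nth_find [::] (a := fun c => z \in c)); rewrite has_find line_ltn_size.
have := mj _ kT; have := mj _ k1T; rewrite -/j -/j'.
set i := index k _; set i' := index k.+1 _ => m' m.
have li : i < size (nth [::] T j) by rewrite index_mem.
have li' : i' < size (nth [::] T j') by rewrite index_mem.
have ei : nth 0 (nth [::] T j) i = k by rewrite nth_index.
have ei' : nth 0 (nth [::] T j') i' = k.+1 by rewrite nth_index.
clearbody i i' j j'; have [sj _ _] := tab_nth j tT; have [sj' _ _] := tab_nth j' tT.
apply/idP/idP => h.
  rewrite leqNgt; apply/negP => jj.
  have [|l1 h1] := tab_dom (i := i) tT (ltnW jj); first by apply: ltn_trans li'.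
  have := ltn_sorted_nth sj' h li'; arith.
rewrite ltnNge; apply/negP => ii.
have [l1 h1] := tab_dom tT h li.
case: (ltngtP i' i) ii => // [lt|eq] _; last by rewrite -eq in h1 ei; arith.
have := ltn_sorted_nth sj' lt l1; arith.
Qed.

(** * Column deletion and placing a new maximum *)

Lemma set_nth_cat_cons (T : Type) (x0 : T) a y e x :
  set_nth x0 (a ++ y :: e) (size a) x = a ++ x :: e.
Proof. by elim: a => //= z a ->. Qed.

Lemma line_ins_bump a y e L x : all (fun z => z < x) a -> x < y ->
  line_ins ((a ++ y :: e) :: L) x = (a ++ x :: e) :: line_ins L y.
Proof.
move=> ax xy /=; rewrite all_cat /= (ltnNge y x) (ltnW xy) andbF find_cat.
have -> : has (fun z => x < z) a = false.
  by apply/negbTE/hasPn => z /(allP ax); arith.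
by rewrite /= xy addn0 nth_cat ltnn subnn set_nth_cat_cons.
Qed.

(** The deletion counterpart of [dom_ins]. The left neighbour of [x] in its row is smaller than [x],
    so there is an entry [x'] to replace, and [x] moves weakly downwards. The alternatives for [e]
    are a next column cut off at [x] and one where [w] has replaced [x]. *)
Lemma col_repl_split (c a2 b2 e : seq nat) (x : nat) :
  sorted ltn c -> x \notin c -> dom c (a2 ++ x :: b2) ->
  all (fun z => x < z) e -> e = [::] \/ (exists w, e = w :: b2) ->
  exists a x' b, [/\ c = a ++ x' :: b, x' < x, all (fun z => x < z) b,
    col_repl c x = (x', a ++ x :: b) & dom (a ++ x :: b) (a2 ++ e)].
Proof.
move=> sc xc [sz h] xe eE.
have [a0 [b [/= ec ax xb _]]] := line_insE (L := [:: c]) sc xc.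
have a2lt : size a2 < size a0.
  rewrite ltnNge; apply/negP => le.
  have := h (size a2); rewrite nth_cat_cons ltnn eqxx ec nth_cat (ltnNge _ (size a0)) le /=.
  move: sz; rewrite ec !size_cat /= => sz.
  have lb : size a2 - size a0 < size b by arith.
  have := allP xb _ (mem_nth 0 lb) => /= h1 /(_ _); arith.
case/lastP: a0 ax ec a2lt => [|a x'] //; rewrite all_rcons size_rcons => /andP[x'x ax] ec a2a.
rewrite cat_rcons in ec.
have cc : (count (fun z => z < x) c).-1 = size a.
  rewrite ec count_cat /= x'x; have -> : count (fun z => z < x) b = 0.
    by apply/eqP; rewrite -leqn0 leqNgt -has_count; apply/hasPn => z /(allP xb); arith.
  by have := ax; rewrite all_count => /eqP ->; rewrite addn0 addn1.
exists a, x', b; split=> //.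
  by rewrite /col_repl cc ec nth_cat ltnn subnn set_nth_cat_cons.
have se : size e <= (size b2).+1 by case: eE => [->|[w ->]].
move: sz h; rewrite ec /dom !size_cat /= => sz h; split; first arith.
move=> i il; rewrite nth_cat_cons.
have hi : i < size a2 + (size b2).+1 by arith.
have := h i hi; rewrite nth_cat_cons [nth 0 (a2 ++ _) i]nth_cat [nth 0 (a2 ++ _) i]nth_cat.
case: (ltnP i (size a2)) => i2.
  have ia : i < size a by arith.
  by rewrite ia.
have ie : i - size a2 < size e by arith.
have xei : x < nth 0 e (i - size a2) by exact: (allP xe _ (mem_nth 0 ie)).
case: (ltnP i (size a)) => ia _.
  by apply: ltn_trans xei; exact: (allP ax _ (mem_nth 0 ia)).
case: (eqVneq i (size a)) => // nia.
have {}ia : size a < i by arith.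
have -> : i - size a2 = (i - size a2).-1.+1 by arith.
case: eE => [e0|[w ->]]; first by rewrite e0 in ie.
have := h i hi; rewrite !nth_cat_cons (ltnNge i (size a)) (ltnW ia) (negbTE nia) /=.
rewrite (ltnNge i (size a2)) i2 /= (_ : (i == size a2) = false); last by arith.
by have -> : i - (size a2).+1 = (i - size a2).-1 by arith.
Qed.

Lemma tab_head_nil T : tab T -> head [::] T = [::] -> T = [::].
Proof. by case: T => //= c T [nc _ _ _] ec; rewrite ec in nc. Qed.

Lemma unbump_cols_cons c cs y :
  let p := unbump_cols cs y in let q := col_repl c p.1 in
  unbump_cols (c :: cs) y = (q.1, q.2 :: p.2).
Proof. by []. Qed.

(* The last clause describes how the first column changes; this is what lets
   the induction prepend a column. *)
Lemma unbump_colsP T0 c y R :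
  let U := T0 ++ rcons c y :: R in
  let x := (unbump_cols T0 y).1 in
  let T' := (unbump_cols T0 y).2 ++ (if c is [::] then [::] else c :: R) in
  tab U -> uniq (flatten U) -> size (head [::] R) <= size c ->
  [/\ tab T', line_ins T' x = U /\ ins_end T' x = size T0,
      perm_eq (x :: flatten T') (flatten U),
      map size (unbump_cols T0 y).2 = map size T0 &
      exists a b e, [/\ head [::] U = a ++ x :: b, head [::] T' = a ++ e,
        all (fun z => x < z) e & e = [::] \/ (exists w, e = w :: b)]].
Proof.
elim: T0 => [|d T0 IH]; cbv zeta.
  rewrite /= => -[_ sc [sz dc] tR] uU; case: c sc sz dc uU => [|c0 c] sc sz dc uU szR.
    (* A column emptied by the deletion is the last one, so discarding it leaves no gap. *)
    have -> : R = [::] by apply: tab_head_nil => //; case: (head _ _) szR.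
    by split=> //; exists [::], [::], [::]; split=> //; left.
  move: sc; rewrite -cats1 => /[dup] /sorted_ltn_cat[sc _] /sorted_ltn_split[cy _ _ _].
  split=> //.
  - split=> //; split=> // i il; have := dc i il.
    by rewrite nth_rcons (leq_trans il szR).
  - by rewrite /= in cy; rewrite /= cy cats1.
  - by apply/permP => p; rewrite /= !count_cat /=; arith.
  - exists (c0 :: c), [::], [::]; split=> //; first by rewrite cats0.
    by left.
rewrite unbump_cols_cons !cat_cons => -[nd sd dd tU].
rewrite [flatten _]/= cat_uniq => /and3P[ud hd uU] szR.
case: (IH tU uU szR) => tT' [li ie] pe szE [a [b [e [hU hT' xe eE]]]].
move: tT' li ie pe szE hU hT' xe eE.
case: (unbump_cols T0 y) => x' P; rewrite ![(x', P).1]/= ![(x', P).2]/=; set T' := P ++ _.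
move=> tT' li ie pe szE hU hT' xe eE.
have xU : x' \in flatten (T0 ++ rcons c y :: R).
  by rewrite -(perm_mem pe) mem_head.
have xd : x' \notin d by apply: contra hd => xd; apply/hasP; exists x'.
rewrite hU in dd.
have [a1 [x1 [b1 [ed x1x xb E dd1]]]] := col_repl_split sd xd dd xe eE.
have [a1x _ sa1 sb1] : [/\ all (fun z => z < x1) a1, all (fun z => x1 < z) b1,
   sorted ltn a1 & sorted ltn b1] by apply: sorted_ltn_split; rewrite -ed.
rewrite E ![(x1, _).1]/= ![(x1, _).2]/= ?cat_cons -/T'; split.
- split=> //; first by case: (a1).
    apply: sorted_ltn_join => //.
    by apply/allP => z /(allP a1x) zx; apply: ltn_trans x1x.
  by rewrite hT'.
- by rewrite line_ins_bump // li ed ins_end_bump // ie.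
- apply/permP => p; have /permP/(_ p) := pe; rewrite ed /= !count_cat /=; arith.
- by rewrite /= szE ed !size_cat.
- exists a1, b1, (x' :: b1); split=> //=.
    rewrite x1x; apply/allP => z /(allP xb); exact: ltn_trans.
  by right; exists x'.
Qed.

Lemma col_delP T i j : tab T -> uniq (flatten T) ->
  size (nth [::] T j) = i.+1 -> size (nth [::] T j.+1) <= i ->
  let p := col_del T i j in
  [/\ tab p.2, line_ins p.2 p.1 = T, ins_end p.2 p.1 = j,
      perm_eq (p.1 :: flatten p.2) (flatten T) &
      forall j', size (nth [::] T j') = size (nth [::] p.2 j') + (j' == j)].
Proof.
move=> tT uT sj sj1 p.
have jT : j < size T by rewrite ltnNge; apply/negP => /(nth_default [::]) h; rewrite h in sj.
set c := nth [::] T j in sj; set y := nth 0 c i.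
have ec : c = rcons (take i c) y.
  by rewrite -take_nth ?sj // -sj take_size.
have eT : T = take j T ++ rcons (take i c) y :: drop j.+1 T.
  by rewrite -ec -drop_nth // cat_take_drop.
have sti : size (take i c) = i by rewrite size_take sj ltnSn.
have stj : size (take j T) = j by rewrite size_take jT.
have hR : size (head [::] (drop j.+1 T)) <= size (take i c).
  by rewrite -nth0 nth_drop addn0 sti.
have := @unbump_colsP (take j T) (take i c) y (drop j.+1 T).
rewrite -eT => /(_ tT uT hR).
have -> : (unbump_cols (take j T) y).1 = p.1.
  rewrite /p /col_del -/c /= -/y [drop i.+1 c]drop_oversize ?sj // cats0.
  case: (take i c) => [|u v]; first by rewrite take_cat stj ltnn subnn take0 cats0.
  by rewrite set_nthE jT take_cat stj ltnn subnn take0 cats0.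
(* When column [j] is emptied, [col_del] drops it and keeps the columns after it, whereas
   [unbump_colsP] keeps none; the two agree because none exist. *)
have hd : take i c = [::] -> drop j.+1 T = [::].
  move=> e0; apply: tab_head_nil; last first.
    by apply/eqP; rewrite -size_eq0 -leqn0 (leq_trans hR) ?e0.
  have := tT; rewrite -{1}(cat_take_drop j.+1 T).
  by elim: (take j.+1 T) => //= ? ? IH [].
set P := (unbump_cols (take j T) y).2; set S := (if take i c is [::] then _ else _).
have eP : P ++ S = p.2.
  rewrite /p /col_del -/c /= -/y [drop i.+1 c]drop_oversize ?sj // cats0 /S.
  case: (take i c) hd => [hd|u v _].
    rewrite take_cat stj ltnn subnn take0 cats0 drop_cat stj ltnn subnn drop0.
    by rewrite hd // !cats0.
  by rewrite set_nthE jT take_cat stj ltnn subnn take0 cats0 drop_cat stj ltnn subnn drop0.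
rewrite eP; case=> tT' [li ie] pe szE _; split=> //; first by rewrite ie stj.
have sP : size P = j by rewrite -(size_map size) szE size_map.
have hS l : size (nth [::] (rcons (take i c) y :: drop j.+1 T) l) =
    size (nth [::] S l) + (l == 0).
  rewrite /S; case: (take i c) hd => [->//|u v _]; first by case: l => [|[]].
  by case: l => [|l] /=; rewrite ?size_rcons ?addn0 // addn1.
move=> j'; rewrite -eP eT !nth_cat sP stj; case: ltnP => jj'.
  rewrite (_ : j' == j = false) ?addn0; last arith.
  have /(congr1 (fun s => nth 0 s j')) := szE.
  by rewrite !(nth_map [::]) ?sP ?stj.
by rewrite hS; congr (_ + _); arith.
Qed.

Lemma place_cons c T i j k : place (c :: T) i j.+1 k = c :: place T i j k.
Proof. by []. Qed.

Lemma place_head T k :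
  place T (size (head [::] T)) 0 k = rcons (head [::] T) k :: behead T.
Proof.
case: T => [|c T] //=; rewrite /place /= set_nthE ltnn subnn /=.
by rewrite -cats1.
Qed.

(** The size hypotheses make the box addable, and a new maximum there violates no order condition.
    The last two clauses serve to compare columns of successive expansions. *)
Lemma placeP T i j k : tab T -> {in flatten T, forall z, z < k} ->
  size (nth [::] T j) = i -> (0 < j -> i < size (nth [::] T j.-1)) ->
  let T' := place T i j k in
  [/\ tab T', perm_eq (flatten T') (k :: flatten T),
      forall j', size (nth [::] T' j') = size (nth [::] T j') + (j' == j),
      {in flatten T, forall z, line T' z = line T z} & line T' k = j].
Proof.
elim: j T => [|j IH] T tT kT sj si /=.
  rewrite -sj nth0 place_head; split.
  - have hk : all (fun z => z < k) (head [::] T).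
      by apply/allP => z zT; apply: kT; rewrite flatten_head_behead mem_cat zT.
    split; first by case: (head _ _).
    + by rewrite -cats1 sorted_ltn_join // tab_head.
    + case: T tT {kT sj si hk} => [|c T] //= [_ _ [sz h] _]; split.
        by rewrite size_rcons; arith.
      by move=> l ll; rewrite nth_rcons (leq_trans ll sz); apply: h.
    + by case: T tT {kT sj si hk} => [|c T] //= [].
  - by rewrite (flatten_head_behead T) /= cat_rcons -cat1s perm_catCA.
  - by case=> [|j'] /=; rewrite ?size_rcons ?nth_behead ?addn0 // -nth0 addn1.
  - move=> z zT; have zk : z != k by have := kT _ zT; arith.
    case: T zT {tT kT sj si} => [|c T] // _.
    by rewrite [head _ _]/= [behead _]/= !line_cons mem_rcons in_cons (negbTE zk).
  - by rewrite line_cons mem_rcons mem_head.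
case: T tT kT sj si => [|c T]; first by move=> _ _ _ /(_ isT); rewrite nth_nil.
move=> [nc sc dc tT] kT sj si; rewrite /= in sj si; rewrite place_cons.
have kT' : {in flatten T, forall z, z < k}.
  by move=> z zT; apply: kT; rewrite /= mem_cat zT orbT.
have kc : k \notin c.
  by apply/negP => kc; have := kT k; rewrite /= mem_cat kc ltnn => /(_ isT).
have si' : 0 < j -> i < size (nth [::] T j.-1).
  by move: si; case: (j) => // j0 /(_ isT).
case: (IH T tT kT' sj si') => tT' pe sz' lz lk; split.
- split=> //; case: j sj si {IH si' sz' lz lk tT' pe} => [|j] sj si.
    rewrite -/(place T i 0 k) -sj nth0 place_head /=; case: dc => sz h; split.
      by rewrite size_rcons -nth0 sj; apply: si.
    move=> l; rewrite size_rcons ltnS leq_eqVlt nth_rcons => /orP[/eqP->|ll].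
      rewrite ltnn eqxx; apply: kT; rewrite /= mem_cat mem_nth //.
      by rewrite -nth0 sj; apply: si.
    by rewrite ll; apply: h.
  case: (T) si dc => [|c1 T1]; first by move=> /(_ isT); rewrite /= nth_nil.
  by [].
- rewrite /= (perm_trans (_ : perm_eq _ (c ++ k :: flatten T))) ?perm_cat2l //.
  by rewrite -cat1s perm_catCA.
- by case=> [|j'] /=; rewrite ?addn0 // sz'.
- move=> z; rewrite [flatten _]/= mem_cat !line_cons; case: (z \in c) => //= zT.
  by rewrite lz.
- by rewrite line_cons (negbTE kc) lk.
Qed.

(** * Oscillating tableaux and the first phase *)

(** [inv_support] before sorting: adjoining a transposition then becomes a concatenation. *)
Definition supp (p : seq (nat * nat)) := flatten [seq [:: q.1; q.2] | q <- p].

Lemma supp_rcons p q : supp (rcons p q) = supp p ++ [:: q.1; q.2].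
Proof. by rewrite /supp map_rcons flatten_rcons. Qed.

Lemma inv_apply_cons q p a : inv_apply (q :: p) a =
  if q.1 == a then q.2 else if q.2 == a then q.1 else inv_apply p a.
Proof. by rewrite /inv_apply /=; case: eqP => //= h; case: eqP => //= _; case: eqP. Qed.

Lemma inv_apply_rcons p q a : inv_apply (rcons p q) a =
  if a \in supp p then inv_apply p a else inv_apply [:: q] a.
Proof.
elim: p => [|u p IH] //; rewrite rcons_cons !inv_apply_cons IH /supp /= !inE.
rewrite !(eq_sym a); case: eqP => //= _; case: eqP => //= _.
by rewrite inv_apply_cons.
Qed.

Lemma inv_apply_mem p a : a \in supp p -> inv_apply p a \in supp p.
Proof.
elim: p => [|u p IH] //; rewrite inv_apply_cons /supp /= !inE.
rewrite !(eq_sym a); case: eqP => [_|_] /=; first by rewrite eqxx orbT.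
by case: eqP => [_|_] /=; [rewrite eqxx | move/IH => ->; rewrite !orbT].
Qed.

Lemma inv_applyK p : uniq (supp p) -> {in supp p, involutive (inv_apply p)}.
Proof.
elim: p => [|u p IH] //; rewrite /supp /= inE negb_or -andbA => /and4P[u12 u1 u2 up] a.
rewrite !inE (inv_apply_cons u p a) !(eq_sym a).
case: eqP => [<- _|n1] /=; first by rewrite inv_apply_cons (negbTE u12) eqxx.
case: eqP => [<- _|n2] /=; first by rewrite inv_apply_cons eqxx.
move=> ap; have m := inv_apply_mem ap.
rewrite inv_apply_cons IH //.
case: eqP => [e|_]; first by rewrite e m in u1.
by case: eqP => [e|_] //; rewrite e m in u2.
Qed.

Lemma part_nth_leq s i j : is_part s -> i <= j -> nth 0 s j <= nth 0 s i.
Proof.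
case/andP => ss _ ij; case: (ltnP j (size s)) => js; last by rewrite nth_default.
have tr : transitive geq by move=> x y z /= xy yz; apply: leq_trans yz xy.
apply: (sorted_leq_nth tr leqnn 0 ss) => //; rewrite inE //.
exact: leq_ltn_trans js.
Qed.

Lemma find_diff_row a b i :
  (forall l, (nth 0 a l != nth 0 b l) = (l == i)) -> i < size a + size b ->
  find (fun l => nth 0 a l != nth 0 b l) (iota 0 (size a + size b)) = i.
Proof.
move=> h il; rewrite (eq_find (a2 := pred1 i)); last by move=> l; rewrite h.
rewrite -[find _ _]/(index i _) -{1}[i]add0n -(nth_iota 0 0 il).
by rewrite index_uniq ?size_iota ?iota_uniq.
Qed.

Lemma sumn_incr_nth s i : sumn (incr_nth s i) = (sumn s).+1.
Proof.
elim: s i => [|n s IH] [|i] //=; first by elim: i.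
by rewrite IH addnS.
Qed.

Lemma osc_stepP r mus k : osc_tab r mus -> k < r ->
  let f := nth 0 (nth [::] mus k) in let g := nth 0 (nth [::] mus k.+1) in
  let i := box_row mus k.+1 in let j := box_col mus k.+1 in
  if is_exp mus k.+1 then f i = j /\ forall l, g l = f l + (l == i)
  else g i = j /\ forall l, f l = g l + (l == i).
Proof.
move=> [_ _ _ /(_ k) h] kr; have {h} [i h] := h kr.
rewrite /is_exp /box_col /box_row /shape_before /shape_after /=.
move: (nth [::] mus k) (nth [::] mus k.+1) h => a b [] ->.
- have -> : find (fun l => nth 0 a l != nth 0 (incr_nth a i) l)
      (iota 0 (size a + size (incr_nth a i))) = i.
    apply: find_diff_row => [l|]; first by rewrite nth_incr_nth; lia.
    by rewrite size_incr_nth; case: (ltnP i (size a)); lia.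
  rewrite sumn_incr_nth ltnSn nth_incr_nth eqxx; split; first by lia.
  by move=> l; rewrite nth_incr_nth; lia.
- have -> : find (fun l => nth 0 (incr_nth b i) l != nth 0 b l)
      (iota 0 (size (incr_nth b i) + size b)) = i.
    apply: find_diff_row => [l|]; first by rewrite nth_incr_nth; lia.
    by rewrite size_incr_nth; case: (ltnP i (size b)); lia.
  rewrite sumn_incr_nth ltnNge leqnSn /= nth_incr_nth eqxx; split; first by lia.
  by move=> l; rewrite nth_incr_nth; lia.
Qed.

Lemma osc_part r mus k i j : osc_tab r mus -> k <= r -> i <= j ->
  nth 0 (nth [::] mus k) j <= nth 0 (nth [::] mus k) i.
Proof.
move=> [sz _ /allP ap _] kr; apply: part_nth_leq; apply: ap.
by rewrite mem_nth // sz.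
Qed.

(** Two boxes are added in succession, in columns [f i1] and [g i2]. A lower second box lies weakly
    left because [h] is a partition; a second box weakly above lies strictly right because [g] is
    one. Two contractions are covered by reading them backwards. *)
Lemma row_col_order (f g h : nat -> nat) i1 i2 :
  (forall i j, i <= j -> g j <= g i) -> (forall i j, i <= j -> h j <= h i) ->
  (forall l, g l = f l + (l == i1)) -> (forall l, h l = g l + (l == i2)) ->
  (i1 < i2) = (g i2 <= f i1).
Proof.
move=> mg mh eg eh; apply/idP/idP => lt.
  have := mh _ _ (ltnW lt); rewrite !eh (eg i1) !eqxx; lia.
rewrite ltnNge; apply/negP => /mg; rewrite (eg i1) eqxx; lia.
Qed.

Definition DesCol (mus : seq (seq nat)) k :=
  let e1 := is_exp mus k in let e2 := is_exp mus k.+1 in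
  let c1 := box_col mus k in let c2 := box_col mus k.+1 in
  if e1 then e2 ==> (c2 <= c1) else ~~ e2 && (c1 <= c2).

Lemma DesOsc_col r mus k : osc_tab r mus -> 0 < k -> k < r ->
  DesOsc r mus k = DesCol mus k.
Proof.
case: k => // k os _ kr; rewrite /DesOsc /DesCol kr /=.
have := osc_stepP os kr; have := osc_stepP os (ltnW kr); cbv zeta.
have m l := @osc_part r mus l _ _ os.
case: (is_exp mus k.+1); case: (is_exp mus k.+2) => //= -[c1 h1] [c2 h2].
- rewrite orbF -c1 -c2; apply: row_col_order h1 h2 => i j; apply: m => //.
  exact: ltnW.
- rewrite -c1 -c2; apply: row_col_order h2 h1 => i j; apply: m.
    exact: ltnW.
  by apply: ltnW; apply: ltnW.
Qed.

(* An entry of [T] counts as matched at time infinity, so the formula reads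
   [inv k.+1 < inv k] except when both entries are still in [T]. *)
Definition desc_state (p : seq (nat * nat)) (T : seq (seq nat)) k :=
  if k \in flatten T then (k.+1 \in flatten T) ==> ~~ line_desc T k
  else (k.+1 \notin flatten T) && (inv_apply p k.+1 < inv_apply p k).

(** The field [inv_last] expresses the column of the last box through the current tableau; this is
    what decides, one step later, whether [m] is a descent. *)
Record phase1_inv mus m (p : seq (nat * nat)) T : Prop := Phase1Inv {
  inv_tab : tab T;
  inv_shape : forall i j,
    (i < size (nth [::] T j)) = (j < nth 0 (nth [::] mus m) i);
  inv_content : perm_eq (flatten T ++ supp p) (iota 1 m);
  inv_desc : forall k, 0 < k -> k < m -> desc_state p T k = DesCol mus k;
  inv_last : 0 < m -> if is_exp mus m
    then m \in flatten T /\ line T m = box_col mus m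
    else m \notin flatten T /\ ins_end T (inv_apply p m) = box_col mus m
}.

Lemma content_facts T p m : perm_eq (flatten T ++ supp p) (iota 1 m) ->
  [/\ uniq (flatten T), uniq (supp p),
      forall z, z \in flatten T -> z \notin supp p &
      forall z, (z \in flatten T) || (z \in supp p) = (0 < z <= m)].
Proof.
move=> pe; have := perm_uniq pe; rewrite iota_uniq cat_uniq => /and3P[uT h up].
split=> // z; last by rewrite -mem_cat (perm_mem pe) mem_iota add1n ltnS.
by move=> zT; apply: contra h => zp; apply/hasP; exists z.
Qed.

(** Placing a maximum moves no other entry, so only the pair [m], [m.+1] is new. It compares two
    columns after an expansion and is never a descent after a contraction. *)
Lemma phase1_expansion r mus m p T : osc_tab r mus -> m < r ->
  is_exp mus m.+1 -> phase1_inv mus m p T ->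
  phase1_inv mus m.+1 p (place T (box_row mus m.+1) (box_col mus m.+1) m.+1).
Proof.
move=> os mr ex [tT sh pe de la].
have := osc_stepP os mr; rewrite /= ex.
set i := box_row _ _; set j := box_col _ _ => -[fi hg].
have mg := @osc_part r mus m.+1 _ _ os mr.
have [uT up dTp mTp] := content_facts pe.
(* Row [i] of the old shape stops before column [j], and row [i.-1] reaches it because the new shape
   is a partition. *)
have sj : size (nth [::] T j) = i.
  have h1 : (i < size (nth [::] T j)) = false by rewrite sh fi ltnn.
  case: (posnP i) => [i0|ip]; first by move: h1; rewrite i0; case: size.
  have : i.-1 < size (nth [::] T j).
    rewrite sh -fi; have := mg i.-1 i (leq_pred i); rewrite !hg eqxx; arith.
  clear -h1 ip; lia.
have si : 0 < j -> i < size (nth [::] T j.-1) by move=> jp; rewrite sh fi; arith.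
have kT : {in flatten T, forall z, z < m.+1}.
  by move=> z zT; have := mTp z; rewrite zT /= => /esym/andP[].
have [tT' pe' sz' lz lk] := placeP tT kT sj si.
set T' := place _ _ _ _ in tT' pe' sz' lz lk *.
have mT' z : (z \in flatten T') = (z == m.+1) || (z \in flatten T).
  by rewrite (perm_mem pe') in_cons.
have KT' : m.+1 \in flatten T' by rewrite mT' eqxx.
split=> //.
- move=> i' j'; rewrite sz' hg; have := sh i' j'.
  have [->|nj] := eqVneq j' j; last first.
    rewrite addn0 => ->; have [ei|_] := eqVneq i' i; last by rewrite addn0.
    by rewrite ei fi; clear -nj; lia.
  rewrite sj; have [->|ni] := eqVneq i' i; first by rewrite fi; clear; lia.
  by rewrite addn0 => <-; clear -ni; lia.
- rewrite -[m.+1]addn1 iotaD /= add1n.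
  apply/permP => P; have /permP/(_ P) := pe; have /permP/(_ P) := pe'.
  rewrite /= !count_cat /= => -> <-; clear; lia.
- move=> k k0; rewrite ltnS leq_eqVlt => /orP[/eqP ek|km].
    have m0 : 0 < m by rewrite -ek.
    have := la m0; rewrite /DesCol -ek /desc_state ek KT' ex mT' (ltn_eqF (ltnSn m)) /=.
    rewrite -/j; case: ifP => _ [mT lm].
      by rewrite mT /= /line_desc lk lz // lm -leqNgt.
    by rewrite (negbTE mT).
  have k1 : (k == m.+1) = false by clear -km; lia.
  have k2 : (k.+1 == m.+1) = false by clear -km; lia.
  rewrite -de // /desc_state !mT' k1 k2 /=.
  case: ifP => // kT1; case: (boolP (k.+1 \in _)) => //= k1T.
  by rewrite /line_desc !lz.
- by rewrite ex.
Qed.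

(** Since [T] is the insertion of [x] into [T'], the insertion rules relate the line descents of the
    two tableaux. *)
Lemma phase1_contraction r mus m p T : osc_tab r mus -> m < r ->
  ~~ is_exp mus m.+1 -> phase1_inv mus m p T ->
  let q := col_del T (box_row mus m.+1) (box_col mus m.+1) in
  phase1_inv mus m.+1 (rcons p (q.1, m.+1)) q.2.
Proof.
move=> os mr ex [tT sh pe de la].
have := osc_stepP os mr; cbv zeta; rewrite (negbTE ex).
set i := box_row _ _; set j := box_col _ _ => -[gi hf].
have mg := @osc_part r mus m.+1 _ _ os mr.
have [uT up dTp mTp] := content_facts pe.
have sj : size (nth [::] T j) = i.+1.
  have h1 : i < size (nth [::] T j) by rewrite sh hf eqxx gi; clear; lia.
  have h2 : (i.+1 < size (nth [::] T j)) = false.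
    have := mg i i.+1 (leqnSn i); rewrite sh hf gi; clear; lia.
  by clear -h1 h2; lia.
have sj1 : size (nth [::] T j.+1) <= i.
  by rewrite leqNgt sh hf eqxx gi; clear; lia.
have := col_delP tT uT sj sj1; cbv zeta.
case: (col_del T i j) => x T'; rewrite [(x, T').1]/= [(x, T').2]/= => -[tT' li ie pe' sz].
have /andP[xT' uT'] : uniq (x :: flatten T') by rewrite (perm_uniq pe').
have wT' : lines T' by rewrite /lines tab_sorted.
have mT z : (z \in flatten T) = (z == x) || (z \in flatten T').
  by rewrite -(perm_mem pe') in_cons.
have xT : x \in flatten T by rewrite mT eqxx.
have xp := dTp _ xT.
have Kp : m.+1 \notin supp p.
  by apply/negP => h; have := mTp m.+1; rewrite h orbT ltnn andbF.
have KT : m.+1 \notin flatten T.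
  by apply/negP => h; have := mTp m.+1; rewrite h ltnn andbF.
have KT' : m.+1 \notin flatten T' by move: KT; rewrite mT negb_or => /andP[].
have xK : (x == m.+1) = false by apply/negbTE; apply: contraNneq KT => <-.
have ox a : a \in supp p -> inv_apply (rcons p (x, m.+1)) a = inv_apply p a.
  by move=> ap; rewrite inv_apply_rcons ap.
have nx : inv_apply (rcons p (x, m.+1)) x = m.+1.
  by rewrite inv_apply_rcons (negbTE xp) inv_apply_cons eqxx.
have nK : inv_apply (rcons p (x, m.+1)) m.+1 = x.
  by rewrite inv_apply_rcons (negbTE Kp) inv_apply_cons xK eqxx.
have bound a : a \in supp p -> inv_apply p a <= m.
  move=> /inv_apply_mem h; have := mTp (inv_apply p a).
  by rewrite h orbT => /esym/andP[].
have inp z : 0 < z -> z <= m -> z \notin flatten T -> z \in supp p.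
  by move=> z0 zm zT; have := mTp z; rewrite (negbTE zT) z0 zm.
split=> //.
- move=> i' j'; have := sh i' j'; rewrite sz hf.
  have [ej|nj] := eqVneq j' j; last first.
    rewrite addn0 => ->; have [ei|_] := eqVneq i' i; last by rewrite addn0.
    by rewrite ei gi; clear -nj; lia.
  have sj' : size (nth [::] T' j) = i by have := sz j; rewrite eqxx sj; clear; lia.
  rewrite ej sj'; have [->|ni] := eqVneq i' i; first by rewrite gi; clear; lia.
  by rewrite addn0 => <-; clear -ni; lia.
- rewrite supp_rcons -[m.+1]addn1 iotaD /= add1n.
  apply/permP => P; have /permP/(_ P) := pe; have /permP/(_ P) := pe'.
  rewrite /= !count_cat /= => <-; rewrite addn1; clear; lia.
- move=> k k0; rewrite ltnS leq_eqVlt => /orP[/eqP ek|km].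
    have m0 : 0 < m by rewrite -ek.
    have := la m0; rewrite /DesCol /desc_state ek (negbTE KT') (negbTE ex) /=.
    rewrite -/j; case: ifP => _ [mmT lm].
      (* An expansion followed by a contraction is a descent: [m] either stays in the tableau or is
         the output [x], in which case it is matched with [m.+1]. *)
      have := mT m; rewrite mmT; case: ifP => // _; rewrite orbF => /esym/eqP mx.
      have := nx; rewrite -[X in inv_apply _ X]mx nK => ->.
      by have := mTp x; rewrite xT => /esym/andP[].
    have mT' : (m \in flatten T') = false.
      by apply/negbTE; move: mmT; rewrite mT negb_or => /andP[].
    have mp := inp _ m0 (leqnn m) mmT.
    rewrite mT' nK ox // -lm -ie -li.
    (* Both steps are contractions. Undoing them inserts [x] first and then [x0], so the bumping
       lemma compares the two columns. *)
    set x0 := inv_apply p m.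
    have x0p : x0 \in supp p by apply: inv_apply_mem.
    have x0T : x0 \notin flatten T.
      by apply/negP => /dTp; rewrite x0p.
    rewrite ins_end_leq //.
      by move: x0T; rewrite mT negb_or => /andP[].
    by apply: contraTneq xT => <-.
  have k1K : k.+1 != m.+1 by clear -km; lia.
  rewrite -de // /desc_state.
  (* A letter leaving the tableau becomes matched with [m.+1], later than all earlier partners. This
     agrees with matching at infinity when the other letter has already left; when the other letter
     stays, an insertion rule gives the old value. *)
  have [kx|nkx] := eqVneq k x.
    have k1x : (k.+1 == x) = false by rewrite -kx; clear; lia.
    have kT' : k \notin flatten T' by rewrite kx.
    have nk : inv_apply (rcons p (x, m.+1)) k = m.+1 by rewrite [X in inv_apply _ X]kx.
    rewrite !mT k1x (negbTE kT') nk (introT eqP kx) /=.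
    have [k1T'|k1T'] := boolP (k.+1 \in _).
      by rewrite -li -kx line_ins_desc_pred.
    have k1p : k.+1 \in supp p by rewrite inp // mT k1x.
    by rewrite /= ox // ltnS bound.
  have [k1x|nk1x] := eqVneq k.+1 x.
    have k1T' : k.+1 \notin flatten T' by rewrite k1x.
    have nk1 : inv_apply (rcons p (x, m.+1)) k.+1 = m.+1.
      by rewrite [X in inv_apply _ X]k1x.
    rewrite !mT (negbTE nkx) (negbTE k1T') nk1 (introT eqP k1x) /=.
    have [kT'|kT'] := boolP (k \in _).
      by rewrite -li -k1x line_ins_desc_succ.
    have kp : k \in supp p by rewrite inp // ?mT ?(negbTE nkx) // ltnW.
    by rewrite (ox k) // ltnNge leqW ?bound.
  rewrite !mT (negbTE nkx) (negbTE nk1x) /=.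
  have [kT'|kT'] := boolP (k \in _).
    have [k1T'|//] := boolP (k.+1 \in _).
    by rewrite -li line_ins_desc // eq_sym.
  have [//|k1T'] := boolP (k.+1 \in _).
  by rewrite !ox // inp // ?mT ?(negbTE nkx) ?(negbTE nk1x) // ltnW.
- rewrite (negbTE ex); split => //.
  by rewrite nK.
Qed.

Lemma sund_phase1_inv r mus m : osc_tab r mus -> m <= r ->
  phase1_inv mus m (sund_phase1 m mus).1 (sund_phase1 m mus).2.
Proof.
move=> os; elim: m => [|m IH] mr.
  split=> // i j; case: os => _ -> _ _; by rewrite !nth_nil.
have {IH} := IH (ltnW mr); rewrite /sund_phase1 -[m.+1]addn1 iotaD foldl_cat addn1 add1n.
case: (foldl _ _ (iota 1 m)) => p T /= inv; rewrite /sund_step.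
have [ex|ex] := boolP (is_exp mus m.+1); first exact: phase1_expansion os mr ex inv.
exact: phase1_contraction os mr ex inv.
Qed.

(** * Row insertion of the involution and the final comparison *)

Lemma index_map_in (T1 T2 : eqType) (f : T1 -> T2) s x :
  {in s &, injective f} -> x \in s -> index (f x) (map f s) = index x s.
Proof.
elim: s => [|y s IH] //= fi xs.
rewrite (inj_in_eq fi) ?mem_head //; case: eqP => // yx; congr _.+1; apply: IH.
  by move=> u v us vs; apply: fi; rewrite inE ?us ?vs orbT.
by move: xs; rewrite inE => /orP[/eqP e|//]; rewrite e in yx.
Qed.

(** As the involution is its own inverse, the letter [z] occurs in the word at the rank of its
    partner in the sorted support. Hence [k.+1] is inserted before [k] exactly when its partner is
    the smaller one. *)
Lemma RS_I_facts p : uniq (supp p) ->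
  [/\ lines (RS_I p), perm_eq (flatten (RS_I p)) (supp p) &
   forall k, k \in supp p -> k.+1 \in supp p ->
     line_desc (RS_I p) k = (inv_apply p k.+1 < inv_apply p k)].
Proof.
move=> up; have iK := inv_applyK up.
have mA : inv_support p =i supp p by move=> z; rewrite mem_sort.
have uA : uniq (inv_support p) by rewrite sort_uniq.
have inj : {in inv_support p &, injective (inv_apply p)}.
  by apply: can_in_inj (inv_apply p) _ => z; rewrite mA; apply: iK.
set w := [seq inv_apply p a | a <- inv_support p].
have uw : uniq w by rewrite map_inj_in_uniq.
have pw : perm_eq w (supp p).
  apply: uniq_perm => // z; apply/mapP/idP => [[a + ->]|zp].
    by rewrite mA; apply: inv_apply_mem.
  by exists (inv_apply p z); rewrite ?mA ?inv_apply_mem ?iK.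
have [lI pI] := foldl_line_ins_perm (L := [::]) isT uw.
split=> //; first exact: perm_trans pI pw.
move=> k kp k1p; rewrite /RS_I -/w foldl_line_ins_desc //= ?(perm_mem pw) //.
have idx z : z \in supp p -> index z w = index (inv_apply p z) (inv_support p).
  by move=> zp; rewrite -{1}(iK z zp) index_map_in // mA inv_apply_mem.
rewrite !idx //.
have sA : sorted ltn (inv_support p).
  by rewrite ltn_sorted_uniq_leq uA sort_sorted // => a b; exact: leq_total.
have := inv_apply_mem kp; have := inv_apply_mem k1p; rewrite -!mA.
move: (inv_apply p k) (inv_apply p k.+1) => a b bA aA.
have h := sorted_ltn_index ltn_trans sA.
apply/idP/idP => [/(h _ _ bA aA) //|ba].
rewrite ltnNge leq_eqVlt; apply/negP => /orP[/eqP e|/(h _ _ aA bA)].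
  have := nth_index 0 aA; rewrite e nth_index // => e'; rewrite e' ltnn in ba; done.
by rewrite ltnNge ltnW.
Qed.

Lemma rev_reading_perm L : perm_eq (rev_reading L) (flatten L).
Proof. by elim: L => //= l L IH; rewrite /rev_reading /= perm_cat ?perm_rev. Qed.

Theorem theorem6p1 (r : nat) (mus : seq (seq nat)) :
  osc_tab r mus -> DesOsc r mus =1 DesTab (sundaram_Q r mus).
Proof.
move=> os k; have [tT _ pe de _] := sund_phase1_inv os (leqnn r).
rewrite /sundaram_Q; set p := (sund_phase1 r mus).1 in pe de *.
set T := (sund_phase1 r mus).2 in tT pe de *.
have [uT up dTp mTp] := content_facts pe.
have [lI pI dI] := RS_I_facts up; set w := rev_reading (RS_I p).
have pw : perm_eq w (supp p) by apply: perm_trans (rev_reading_perm _) pI.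
have pTw : perm_eq (flatten T ++ w) (iota 1 r).
  by apply: perm_trans pe; rewrite perm_cat2l.
have uTw : uniq (flatten T ++ w) by rewrite (perm_uniq pTw) iota_uniq.
have wT : lines T by rewrite /lines tab_sorted.
have [_ pQ] := foldl_line_ins_perm wT uTw.
have tQ := foldl_line_ins_tab tT uTw.
have mQ z : (z \in flatten (foldl line_ins T w)) = (0 < z <= r).
  by rewrite (perm_mem pQ) (perm_mem pTw) mem_iota add1n ltnS.
have mTw z : (z \in flatten T ++ w) = (0 < z <= r) by rewrite -mQ (perm_mem pQ).
rewrite /DesTab !mQ; have [k0|/=] := boolP (0 < k); last first.
  by rewrite -leqNgt leqn0 => /eqP ->.
have [kr|/=] := boolP (k < r); last by move=> nkr; rewrite /DesOsc (negbTE nkr) andbF andbF.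
rewrite DesOsc_col // -de // (ltnW kr) /=.
rewrite row_of_desc ?mQ ?k0 ?kr ?(ltnW kr) // foldl_line_ins_desc ?mTw ?k0 ?kr ?(ltnW kr) //.
rewrite /desc_state; case: ifP => kT; first by case: ifP.
case: (boolP (k.+1 \in _)) => //= k1T.
have kp : k \in supp p by have := mTp k; rewrite kT k0 (ltnW kr).
have k1p : k.+1 \in supp p by have := mTp k.+1; rewrite (negbTE k1T) kr.
(* Two negations cancel: line descents of the columns of [Q] are its non-descents, and the reverse
   reading word has [k.+1] before [k] exactly at the non-descents of [RS_I p]. *)
by rewrite index_rev_reading ?(perm_mem pI) // -ltnNge -/(line_desc _ _) dI.
Qed.
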